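(* Let $L$ be a $13$-colorable link with non-zero determinant. If some diagram of $L$ can be non-trivially $13$-colored with colors from a color set $S\subseteq\mathbb{Z}_{13}$ with $|S|=5$, then $S$ is equivalent mod $13$ to $\{0,1,2,4,7\}$. Specifically, if $\mathrm{mincol}_{13} L'=5$ holds for all $13$-colorable links $L'$ with non-zero determinant, then $\{0,1,2,4,7\}$ is, up to equivalence of color sets mod $13$, the only common $13$-minimal sufficient set of colors.
   Context: Links are classical links in 3-space, and all links considered have non-zero determinant. For an integer $m>1$, a (Fox) $m$-coloring of a link diagram is an assignment of elements (''colors'') of $\mathbb{Z}_m=\{0,1,\ldots,m-1\}$ to the arcs of the diagram such that at each crossing twice the color of the over-arc equals the sum of the colors of the two under-arcs modulo $m$. A coloring is non-trivial if it uses at least two distinct colors. A link is $m$-colorable if it has a diagram with a non-trivial $m$-coloring (equivalently, every diagram of it has one). For an $m$-colorable link $L$ and a diagram $D$ of $L$, let $n_{m,D}$ be the minimum number of distinct colors used by a non-trivial $m$-coloring of $D$; then $\mathrm{mincol}_m L=\min\{n_{m,D}\mid D \text{ is a diagram of } L\}$. An $m$-coloring automorphism is a permutation $f$ of $\mathbb{Z}_m$ such that $f(a\ast b)=f(a)\ast f(b)$ for all $a,b\in\mathbb{Z}_m$, where $x\ast y=2y-x \pmod m$; these are exactly the maps $f_{\lambda,\mu}(x)=\lambda x+\mu$ with $\mu\in\mathbb{Z}_m$ and $\lambda$ a unit of $\mathbb{Z}_m$. Two color sets (subsets of $\mathbb{Z}_m$) $S_1,S_2$ are equivalent mod $m$ if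 there is an $m$-coloring automorphism $f_{\lambda,\mu}$ with $f_{\lambda,\mu}(S_1)=S_2$. Suppose $m$ is such that $\mathrm{mincol}_m L=\mathrm{mincol}_m L'$ for any two $m$-colorable links $L,L'$ (with non-zero determinant), and denote this common value by $\mathrm{mincol}(m)$. A common $m$-minimal sufficient set of colors is a set $S$ of $\mathrm{mincol}(m)$ elements of $\mathbb{Z}_m$ such that every $m$-colorable link (with non-zero determinant) has a diagram with a non-trivial $m$-coloring using only colors from $S$. *)

(* Defs.v *)
(* Library: Mathematical Components. *)
From HB Require Import structures.
From Stdlib Require Import Relation_Operators.
From mathcomp Require Import all_boot all_order all_fingroup all_algebra.

Set Implicit Arguments.
Unset Strict Implicit.
Unset Printing Implicit Defensive.

Import GRing.Theory.

(** * Link diagrams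

    A diagram on the sphere is encoded by a planar-diagram (PD) code: the edges
    of the underlying 4-valent plane graph are labelled by natural numbers, and
    a crossing lists its four edges counterclockwise, starting with an edge of
    the under-strand.  In [Crossing a b c d] the under-strand thus runs from [a]
    to [c] and the over-strand from [b] to [d].

    Edges may moreover be subdivided by marked points [Point a b], which carry
    no information; a circle without crossings is [Point a a].  Links are
    unoriented. *)

Inductive vertex : Type :=
  | Crossing of nat & nat & nat & nat
  | Point of nat & nat.

Definition code_of_vertex (v : vertex) : nat * nat * nat * nat + nat * nat :=
  match v with
  | Crossing a b c d => inl (a, b, c, d)
  | Point a b => inr (a, b)
  end.

Definition vertex_of_code (s : nat * nat * nat * nat + nat * nat) : vertex :=
  match s with
  | inl (a, b, c, d) => Crossing a b c d
  | inr (a, b) => Point a b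
  end.

Lemma code_of_vertexK : cancel code_of_vertex vertex_of_code.
Proof. by case. Qed.

HB.instance Definition _ := Equality.copy vertex (can_type code_of_vertexK).

Definition ends (v : vertex) : seq nat :=
  match v with
  | Crossing a b c d => [:: a; b; c; d]
  | Point a b => [:: a; b]
  end.

Definition relabel_vertex (f : nat -> nat) (v : vertex) : vertex :=
  match v with
  | Crossing a b c d => Crossing (f a) (f b) (f c) (f d)
  | Point a b => Point (f a) (f b)
  end.

Definition pdcode := seq vertex.

Definition labels (D : pdcode) : seq nat := flatten (map ends D).

Definition well_labelled (D : pdcode) : bool :=
  all (fun e => count_mem e (labels D) == 2) (labels D).

(** ** Planarity

    A dart is a vertex together with one of its edge ends.  [node] turns
    counterclockwise around the vertex, [other_end] goes to the other end of the
    same edge, and the faces are the orbits of their composite.  The surface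
    defined by this combinatorial map is a disjoint union of spheres exactly
    when Euler's formula V + F = E + 2 C holds, C being the number of connected
    components of the graph.  How the components of a disconnected diagram are
    placed with respect to each other does not affect the link. *)

Definition dart (D : pdcode) : finType :=
  {v : 'I_(size D) & 'I_(size (ends (tnth (in_tuple D) v)))}.

Definition dart_label (D : pdcode) (x : dart D) : nat :=
  nth 0 (ends (tnth (in_tuple D) (tag x))) (tagged x).

Definition node (D : pdcode) (x : dart D) : dart D :=
  Tagged (fun v => 'I_(size (ends (tnth (in_tuple D) v)))) (ordS (tagged x)).

Definition other_end (D : pdcode) (x : dart D) : dart D :=
  odflt x [pick y | (y != x) && (dart_label y == dart_label x)].

Definition graph_adj (D : pdcode) : rel (dart D) :=
  relU (frel (@node D)) (frel (@other_end D)).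

Definition planar (D : pdcode) : bool :=
  size D + fcard (fun x : dart D => node (other_end x)) (dart D)
    == #|dart D|./2 + (n_comp (@graph_adj D) (dart D)).*2.

Record diagram : Type := Diagram {
  pd :> pdcode;
  pd_well_labelled : well_labelled pd;
  pd_planar : planar pd }.

(** ** Links

    By Reidemeister's theorem, links in 3-space up to isotopy are diagrams up to
    the moves below.  Each move replaces a tangle by another one with the same
    boundary edges.  It is only used between two valid diagrams, so that labels
    interior to a tangle occur nowhere else, and planarity of both sides of
    [step_R2] means that the two strands can be pushed over each other across a
    common face.  The positions of kinks, bigons and triangles not listed are
    obtained from those listed by renaming edges and by [step_rot] and
    [step_perm]; [step_merge] and its inverse subdivide and rename edges. *)

Inductive step : pdcode -> pdcode -> Prop :=
  | step_perm D D' : perm_eq D D' -> step D D'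
  | step_rot a b c d D :
      step (Crossing a b c d :: D) (Crossing c d a b :: D)
  | step_flip a b D : step (Point a b :: D) (Point b a :: D)
  | step_merge a b D : a != b ->
      step (Point a b :: D)
           (map (relabel_vertex (fun e => if e == b then a else e)) D)
  | step_R1 a b c D : step (Crossing a a b c :: D) (Point b c :: D)
  | step_R1' a b c D : step (Crossing b a a c :: D) (Point b c :: D)
  (* the strand [p q] passes over the strand [r s] *)
  | step_R2 m n p q r s D :
      step (Crossing r m n p :: Crossing s q n m :: D)
           (Point p q :: Point r s :: D)
  (* strands [x1 x4], [x2 x5], [x3 x6], from top to bottom; the boundary edges
     are [x1], ..., [x6] counterclockwise *)
  | step_R3 a b c x1 x2 x3 x4 x5 x6 D :
      step (Crossing x2 a b x1 :: Crossing x3 x4 c a :: Crossing x6 b c x5 :: D)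
           (Crossing x5 a b x4 :: Crossing x6 x1 c a :: Crossing x3 b c x2 :: D)
  (* the same strands, from bottom to top *)
  | step_R3' a b c x1 x2 x3 x4 x5 x6 D :
      step (Crossing x1 x2 a b :: Crossing x4 c a x3 :: Crossing x5 x6 b c :: D)
           (Crossing x4 x5 a b :: Crossing x1 c a x6 :: Crossing x2 x3 b c :: D).

Definition diagram_equiv : diagram -> diagram -> Prop :=
  clos_refl_sym_trans diagram (fun D D' => step D D').

Record link : Type := Link {
  diagram_of : diagram -> Prop;
  link_class : exists D0, forall D, diagram_of D <-> diagram_equiv D0 D }.

(** * Arcs and determinant *)

(* [e] is followed by [e'] without passing under a crossing. *)
Definition continues (D : pdcode) (e e' : nat) : bool :=
  has (fun v => match v with
                | Crossing a b c d => (e, e') \in [:: (b, d); (d, b)]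
                | Point a b => (e, e') \in [:: (a, b); (b, a)]
                end) D.

Definition edge (D : pdcode) : finType := seq_sub (labels D).

Definition arcs (D : pdcode) : {set {set edge D}} :=
  [set [set e' | connect (fun x y : edge D => continues D (val x) (val y)) e e']
     | e : edge D].

Definition in_arc (D : pdcode) (A : {set edge D}) (e : nat) : bool :=
  e \in map val (enum A).

Definition crossings (D : pdcode) : seq vertex :=
  filter (fun v => if v is Crossing _ _ _ _ then true else false) D.

(* Rows are crossings and columns are arcs.  There are as many arcs as crossings,
   plus one for each component that passes under no crossing; zero rows are
   added for the latter to make the matrix square. *)
Definition coloring_matrix (D : pdcode) : 'M[int]_#|arcs D| :=
  (\matrix_(i, j)
     let A := enum_val j in
     if nth (Point 0 0) (crossings D) i is Crossing a b c d
     then (in_arc A b)%:R *+ 2 - (in_arc A a)%:R - (in_arc A c)%:R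
     else 0)%R.

(* All first minors of all the diagrams of a link have the same absolute value. *)
Definition has_determinant (L : link) (d : nat) : Prop :=
  exists D : diagram, diagram_of L D /\
  exists i j : 'I_#|arcs D|,
    d = absz (\det (row' i (col' j (coloring_matrix D))))%R.

Definition nonzero_determinant (L : link) : Prop :=
  exists d, has_determinant L d /\ d != 0.

(** * Fox colorings

    The modulus [m] is always assumed to be greater than 1. *)

Definition fox_op (m : nat) (x y : 'Z_m) : 'Z_m := (y *+ 2 - x)%R.

(* A color assignment to the arcs is a color assignment to the edges that is
   constant along arcs; values outside of [labels D] are irrelevant. *)
Definition is_coloring (m : nat) (D : pdcode) (col : nat -> 'Z_m) : Prop :=
  (forall e e', continues D e e' -> col e = col e') /\
  (forall a b c d, Crossing a b c d \in D ->
     (col b *+ 2 = col a + col c)%R).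

Definition colors (m : nat) (D : pdcode) (col : nat -> 'Z_m) : {set 'Z_m} :=
  [set x in map col (labels D)].

Definition nontrivial_coloring (m : nat) (D : pdcode) (col : nat -> 'Z_m) : Prop :=
  is_coloring D col /\ 1 < #|colors D col|.

Definition colorable (m : nat) (L : link) : Prop :=
  exists (D : diagram) (col : nat -> 'Z_m),
    diagram_of L D /\ nontrivial_coloring D col.

Definition colorable_from (m : nat) (L : link) (S : {set 'Z_m}) : Prop :=
  exists (D : diagram) (col : nat -> 'Z_m),
    [/\ diagram_of L D, nontrivial_coloring D col & colors D col \subset S].

Definition is_minimum (P : nat -> Prop) (n : nat) : Prop :=
  P n /\ forall k, P k -> n <= k.

Definition is_mincol_diagram (m : nat) (D : diagram) (n : nat) : Prop :=
  is_minimum (fun k => exists col : nat -> 'Z_m,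
                nontrivial_coloring D col /\ #|colors D col| = k) n.

Definition is_mincol (m : nat) (L : link) (n : nat) : Prop :=
  is_minimum (fun k => exists D : diagram,
                diagram_of L D /\ is_mincol_diagram m D k) n.

Definition is_common_mincol (m n : nat) : Prop :=
  forall L : link, colorable m L -> nonzero_determinant L -> is_mincol m L n.

(** * Equivalence of color sets *)

Definition is_coloring_automorphism (m : nat) (f : {perm 'Z_m}) : Prop :=
  forall x y : 'Z_m, f (fox_op x y) = fox_op (f x) (f y).

Definition colorset_equiv (m : nat) (S1 S2 : {set 'Z_m}) : Prop :=
  exists f : {perm 'Z_m}, is_coloring_automorphism f /\ f @: S1 = S2.

Definition common_minimal_sufficient (m : nat) (S : {set 'Z_m}) : Prop :=
  is_common_mincol m #|S| /\
  forall L : link, colorable m L -> nonzero_determinant L -> colorable_from L S.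

(* Main.v *)
(** Nonzero determinant means that every integer-valued Fox coloring is constant,
    a property that Reidemeister moves preserve.  Let T be the set of colors used
    by a nontrivial 13-coloring with at most 5 colors.  A function phi from T to
    the integers satisfying 2 phi(b) = phi(a) + phi(c) whenever a, b, c in T
    satisfy 2b = a + c mod 13 turns the coloring into an integer-valued one, so
    all such phi are constant.  After an affine change of coordinates T contains 0
    and 1, and a search through the remaining sets exhibits a nonconstant phi with
    values between 0 and 6 on each of them, except on the affine images of
    {0, 1, 2, 4, 7}.  The uniqueness of the common minimal sufficient set also
    needs one 13-colorable link of nonzero determinant: the knot 6_3. *)

Require Import Defs.
From Stdlib Require Import Relation_Operators.
From mathcomp Require Import all_boot all_order all_fingroup all_algebra.
From mathcomp Require Import zify ring.

Set Implicit Arguments.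
Unset Strict Implicit.
Unset Printing Implicit Defensive.

Import GRing.Theory.

Local Open Scope ring_scope.

(** * Edge colorings with values in an abelian group *)

Definition colors_vertex (R : zmodType) (x : nat -> R) (v : vertex) : Prop :=
  match v with
  | Crossing a b c d => x b = x d /\ x b *+ 2 = x a + x c
  | Point a b => x a = x b
  end.

(** Imposing the condition vertex by vertex makes a Reidemeister move change only the conditions of
    the vertices it replaces. The group is [int] for rigidity and ['Z_m] for Fox colorings. *)
Definition edge_coloring (R : zmodType) (D : pdcode) (x : nat -> R) : Prop :=
  {in D, forall v, colors_vertex x v}.

Lemma edge_coloringP (R : zmodType) (D : pdcode) (x : nat -> R) :
  (forall e e', continues D e e' -> x e = x e') /\
  (forall a b c d, Crossing a b c d \in D -> x b *+ 2 = x a + x c) <->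
  edge_coloring D x.
Proof.
split=> [[hc hx] [a b c d|a b] vD /=|hD].
- split; last exact: hx vD.
  by apply: hc; apply/hasP; exists (Crossing a b c d) => //; rewrite !inE eqxx.
- by apply: hc; apply/hasP; exists (Point a b) => //; rewrite !inE eqxx.
- split=> [e e' /hasP[[a b c d|a b] /hD]|a b c d /hD[]//] /=.
    by case=> xbd _; rewrite !inE => /orP[] /eqP[-> ->].
  by move=> xab; rewrite !inE => /orP[] /eqP[-> ->].
Qed.

Lemma edge_coloring_cons (R : zmodType) (v : vertex) (D : pdcode) (x : nat -> R) :
  edge_coloring (v :: D) x <-> colors_vertex x v /\ edge_coloring D x.
Proof.
split=> [h|[hv hD] w]; last by rewrite inE => /predU1P[->|/hD].
by split=> [|w wD]; apply: h; rewrite inE ?eqxx ?wD ?orbT.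
Qed.

Lemma labels_cons (v : vertex) (D : pdcode) : labels (v :: D) = ends v ++ labels D.
Proof. by []. Qed.

Lemma mem_labels (D : pdcode) (v : vertex) (e : nat) :
  v \in D -> e \in ends v -> e \in labels D.
Proof. by move=> vD ev; apply/flattenP; exists (ends v) => //; apply: map_f. Qed.

Lemma eq_edge_coloring (R : zmodType) (D : pdcode) (x y : nat -> R) :
  {in labels D, x =1 y} -> edge_coloring D x -> edge_coloring D y.
Proof.
move=> exy hx v vD.
have e u : u \in ends v -> y u = x u by move/(mem_labels vD)/exy.
by case: v {vD} (hx v vD) e => [a b c d|a b] /= hv e; rewrite !e ?inE ?eqxx ?orbT.
Qed.

Definition constant_on (s : seq nat) (x : nat -> int) : Prop :=
  exists k, all (fun e => x e == k) s.

(** * Invariance of rigidity under Reidemeister moves *)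

Definition rigid (D : pdcode) : Prop :=
  forall x, edge_coloring D x -> constant_on (labels D) x.

(** Here [t] stands for the interior edges of a tangle. A label of a valid code occurs exactly
    twice, and the two copies of [t] already use up both occurrences. *)
Lemma fresh_labels (D : pdcode) (t s : seq nat) :
  well_labelled D -> perm_eq (labels D) (t ++ t ++ s) ->
  uniq t /\ {in s, forall e, e \notin t}.
Proof.
move=> /allP wl pe.
have ct e : e \in t -> count_mem e t = 1%N /\ count_mem e s = 0%N.
  move=> et; have := et; rewrite -has_pred1 has_count.
  have /wl: e \in labels D by rewrite (perm_mem pe) mem_cat et.
  by rewrite (seq.permP pe) !count_cat; lia.
split; first apply: count_mem_uniq => e.
  by case: (boolP (e \in t)) => [/ct[]|/count_memPn].
by move=> e es; apply/negP => /ct[_ /count_memPn]; rewrite es.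
Qed.

(** Rigidity travels backwards along this relation, from [D'] to [D]: rigidity of [D'] makes [y]
    constant, which must force [x] to be constant. *)
Definition extends_to (D D' : pdcode) : Prop :=
  forall x, edge_coloring D x -> exists2 y, edge_coloring D' y &
    constant_on (labels D') y -> constant_on (labels D) x.

Lemma extends_to_rigid (D D' : pdcode) : extends_to D D' -> rigid D' -> rigid D.
Proof. by move=> ext rD' x /ext[y /rD' cy]; apply. Qed.

Lemma extends_to_refl (D D' : pdcode) :
  {subset D' <= D} -> {subset labels D <= labels D'} -> extends_to D D'.
Proof.
move=> sD sl x hx; exists x; first by move=> v /sD /hx.
by case=> k /allP hk; exists k; apply/allP=> e /sl /hk.
Qed.

Definition recolor (x : nat -> int) (t : seq nat) (v : seq int) : nat -> int :=
  fun e => if e \in t then v`_(index e t) else x e.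

(** Freshness of the interior edges [t] lets them be recolored without disturbing [D] or the
    boundary edges [s]. The equation between lists splits by injection into one value per tangle
    edge. *)
Lemma recolor_tangle (T D : pdcode) (t s : seq nat) (v : seq int) (x : nat -> int) :
  let y := recolor x t v in
  perm_eq (labels T) (t ++ t ++ s) -> well_labelled (T ++ D) -> size v = size t ->
  edge_coloring D x ->
  [/\ map y (t ++ s) = v ++ map x s, edge_coloring D y &
      forall k, all (fun e => y e == k) (labels D) = all (fun e => x e == k) (labels D)].
Proof.
move=> y pe wl szv hD.
have [|ut sN] := fresh_labels (t := t) (s := s ++ labels D) wl.
  by rewrite /labels map_cat flatten_cat !catA perm_cat2r -catA.
have yE e : e \in s ++ labels D -> y e = x e.
  by move/sN; rewrite /y /recolor => /negPf ->.
have eD : {in labels D, y =1 x} by move=> e eD; rewrite yE // mem_cat eD orbT.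
split.
- rewrite map_cat; congr (_ ++ _); last first.
    by apply/eq_in_map => e es; rewrite yE // mem_cat es.
  apply: (@eq_from_nth _ 0) => [|i]; rewrite size_map // => it.
  by rewrite (nth_map 0%N) // /y /recolor mem_nth // index_uniq.
- by apply: eq_edge_coloring hD => e /eD.
- by move=> k; apply: eq_in_all => e /eD ->.
Qed.

Ltac perm_labels := rewrite /labels; apply/seq.permP => ? /=; ring.

Ltac color_tangle :=
  repeat (apply/edge_coloring_cons; split=> /=; first lia); try done.

Ltac constant_labels k :=
  let hk := fresh "hk" in
  move=> hk; do ![case/andP: hk => /eqP ? hk]; exists k; rewrite ?labels_cons /=;
  do ![apply/andP; split; first (apply/eqP; lia)]; exact: hk.

Lemma extends_to_rot a b c d D :
  extends_to (Crossing a b c d :: D) (Crossing c d a b :: D).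
Proof.
move=> x /edge_coloring_cons[/= h hD]; exists x; first by color_tangle.
by case=> k; rewrite !labels_cons /=; constant_labels k.
Qed.

Lemma extends_to_flip a b D :
  extends_to (Point a b :: D) (Point b a :: D).
Proof.
move=> x /edge_coloring_cons[/= h hD]; exists x; first by color_tangle.
by case=> k; rewrite !labels_cons /=; constant_labels k.
Qed.

Lemma extends_to_R1 a b c D :
  extends_to (Crossing a a b c :: D) (Point b c :: D).
Proof.
move=> x /edge_coloring_cons[/= h hD]; exists x; first by color_tangle.
by case=> k; rewrite !labels_cons /=; constant_labels k.
Qed.

Lemma extends_from_R1 a b c D : well_labelled (Crossing a a b c :: D) ->
  extends_to (Point b c :: D) (Crossing a a b c :: D).
Proof.
move=> wl x /edge_coloring_cons[/= h hD].
have pe : perm_eq (labels [:: Crossing a a b c]) ([:: a] ++ [:: a] ++ [:: b; c]).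
  by perm_labels.
(* The loop of the kink takes the color of the strand. *)
have [] := recolor_tangle (D := D) (v := [:: x b]) pe wl erefl hD.
set y := recolor _ _ _; move=> /= [ya yb yc] hD' yD.
exists y; first by color_tangle.
by case=> k; rewrite !labels_cons /= yD; constant_labels k.
Qed.

Lemma extends_to_R1' a b c D :
  extends_to (Crossing b a a c :: D) (Point b c :: D).
Proof.
move=> x /edge_coloring_cons[/= h hD]; exists x; first by color_tangle.
by case=> k; rewrite !labels_cons /=; constant_labels k.
Qed.

Lemma extends_from_R1' a b c D : well_labelled (Crossing b a a c :: D) ->
  extends_to (Point b c :: D) (Crossing b a a c :: D).
Proof.
move=> wl x /edge_coloring_cons[/= h hD].
have pe : perm_eq (labels [:: Crossing b a a c]) ([:: a] ++ [:: a] ++ [:: b; c]).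
  by perm_labels.
have [] := recolor_tangle (D := D) (v := [:: x b]) pe wl erefl hD.
set y := recolor _ _ _; move=> /= [ya yb yc] hD' yD.
exists y; first by color_tangle.
by case=> k; rewrite !labels_cons /= yD; constant_labels k.
Qed.

Lemma extends_to_R2 m n p q r s D :
  extends_to (Crossing r m n p :: Crossing s q n m :: D)
             (Point p q :: Point r s :: D).
Proof.
move=> x /edge_coloring_cons[/= h1] /edge_coloring_cons[/= h2 hD].
exists x; first by color_tangle.
by case=> k; rewrite !labels_cons /=; constant_labels k.
Qed.

Lemma extends_from_R2 m n p q r s D :
  well_labelled (Crossing r m n p :: Crossing s q n m :: D) ->
  extends_to (Point p q :: Point r s :: D)
             (Crossing r m n p :: Crossing s q n m :: D).
Proof.
move=> wl x /edge_coloring_cons[/= h1] /edge_coloring_cons[/= h2 hD].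
have pe : perm_eq (labels [:: Crossing r m n p; Crossing s q n m])
    ([:: m; n] ++ [:: m; n] ++ [:: p; q; r; s]).
  by perm_labels.
(* Edge [m] lies on the over-strand from [p] to [q]; the color of [n] is forced at the crossing
   where [r] passes under [m]. *)
have [] := recolor_tangle (D := D) (v := [:: x p; x p *+ 2 - x r]) pe wl erefl hD.
set y := recolor _ _ _; move=> /= [ym yn yp yq yr ys] hD' yD.
exists y; first by color_tangle.
by case=> k; rewrite !labels_cons /= yD; constant_labels k.
Qed.

(* Shifting the boundary edges by 3 exchanges the two sides of a third move, so
   that only one direction is needed. *)
Lemma extends_to_R3 a b c x1 x2 x3 x4 x5 x6 D :
  let T := [:: Crossing x2 a b x1; Crossing x3 x4 c a; Crossing x6 b c x5] in
  well_labelled (T ++ D) ->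
  extends_to (T ++ D)
    (Crossing x5 a b x4 :: Crossing x6 x1 c a :: Crossing x3 b c x2 :: D).
Proof.
move=> T wl x /edge_coloring_cons[/= h1] /edge_coloring_cons[/= h2].
move=> /edge_coloring_cons[/= h3 hD].
have pe : perm_eq (labels T)
    ([:: a; b; c] ++ [:: a; b; c] ++ [:: x1; x2; x3; x4; x5; x6]).
  by perm_labels.
(* After the move [a] still lies on the top strand, [b] continues [x2] over the bottom strand, and
   [c] is forced at the crossing where [x6] passes under the top strand. *)
have [] := recolor_tangle (v := [:: x a; x x2; x a *+ 2 - x x6]) pe wl erefl hD.
set y := recolor _ _ _; move=> /= [ya yb yc y1 y2 y3 y4 y5 y6] hD' yD.
exists y; first by color_tangle.
by case=> k; rewrite !labels_cons /= yD; constant_labels k.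
Qed.

Lemma extends_to_R3' a b c x1 x2 x3 x4 x5 x6 D :
  let T := [:: Crossing x1 x2 a b; Crossing x4 c a x3; Crossing x5 x6 b c] in
  well_labelled (T ++ D) ->
  extends_to (T ++ D)
    (Crossing x4 x5 a b :: Crossing x1 c a x6 :: Crossing x2 x3 b c :: D).
Proof.
move=> T wl x /edge_coloring_cons[/= h1] /edge_coloring_cons[/= h2].
move=> /edge_coloring_cons[/= h3 hD].
have pe : perm_eq (labels T)
    ([:: a; b; c] ++ [:: a; b; c] ++ [:: x1; x2; x3; x4; x5; x6]).
  by perm_labels.
(* Now [c] lies on the top strand, [b] continues [x5], and [a] is forced where [x1] passes under the
   top strand. *)
have [] := recolor_tangle (v := [:: x x6 *+ 2 - x x1; x x5; x c]) pe wl erefl hD.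
set y := recolor _ _ _; move=> /= [ya yb yc y1 y2 y3 y4 y5 y6] hD' yD.
exists y; first by color_tangle.
by case=> k; rewrite !labels_cons /= yD; constant_labels k.
Qed.

Lemma labels_relabel (f : nat -> nat) (D : pdcode) :
  labels (map (relabel_vertex f) D) = map f (labels D).
Proof.
by rewrite /labels map_flatten -!map_comp; congr flatten; apply: eq_map; case.
Qed.

Lemma edge_coloring_relabel (f : nat -> nat) (D : pdcode) (x : nat -> int) :
  edge_coloring (map (relabel_vertex f) D) x <-> edge_coloring D (x \o f).
Proof.
split=> [h v vD|h _ /mapP[v vD ->]]; last by case: v vD (h v vD).
by case: v vD (h _ (map_f (relabel_vertex f) vD)).
Qed.

Definition merge (a b e : nat) : nat := if e == b then a else e.

Lemma extends_to_merge a b D : a != b -> well_labelled (Point a b :: D) ->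
  extends_to (Point a b :: D) (map (relabel_vertex (merge a b)) D).
Proof.
move=> ab wl x /edge_coloring_cons[/= xab hD].
have xm : x \o merge a b =1 x by move=> e; rewrite /= /merge; case: eqP => [->|].
exists x; first by apply/edge_coloring_relabel; apply: eq_edge_coloring hD => e _.
(* As [a != b], the marked point accounts for only one of the two occurrences of [a]; the other one
   ties the point to [D]. *)
have aD : a \in labels D.
  have /allP/(_ a) := wl; rewrite labels_cons /= !inE !eqxx /= => /(_ isT).
  by rewrite [b == a]eq_sym (negPf ab) -has_pred1 has_count add0n add1n eqSS => /eqP->.
case=> k; rewrite labels_relabel all_map => hk; exists k.
have {}hk : all (fun e => x e == k) (labels D).
  rewrite -(eq_all (a1 := preim (merge a b) (fun e => x e == k))) // => e /=.
  by rewrite -[in RHS]xm.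
by rewrite labels_cons /= -xab (allP hk a aD).
Qed.

Lemma extends_from_merge a b D :
  extends_to (map (relabel_vertex (merge a b)) D) (Point a b :: D).
Proof.
move=> x /edge_coloring_relabel hD; exists (x \o merge a b).
  apply/edge_coloring_cons; split=> //=.
  by rewrite /merge eqxx; case: eqP.
by case=> k; rewrite labels_cons => /and3P[_ _ hk]; exists k; rewrite labels_relabel all_map.
Qed.

Lemma mem_labels_perm (D D' : pdcode) : D =i D' -> {subset labels D <= labels D'}.
Proof.
move=> eqD e /flattenP[_ /mapP[v vD ->] ev].
by apply: mem_labels ev; rewrite -eqD.
Qed.

Lemma step_rigid (D D' : pdcode) :
  well_labelled D -> well_labelled D' -> step D D' -> rigid D <-> rigid D'.
Proof.
move=> wl wl' st.
suff [e e'] : extends_to D D' /\ extends_to D' D.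
  by split; apply: extends_to_rigid.
case: D D' / st wl wl'.
- move=> D D' /perm_mem eqD _ _.
  by split; apply: extends_to_refl => [v|e]; rewrite ?eqD //; apply: mem_labels_perm.
- by move=> a b c d D _ _; split; apply: extends_to_rot.
- by move=> a b D _ _; split; apply: extends_to_flip.
- by move=> a b D ab wl _; split; [apply: extends_to_merge|apply: extends_from_merge].
- by move=> a b c D wl _; split; [apply: extends_to_R1|apply: extends_from_R1].
- by move=> a b c D wl _; split; [apply: extends_to_R1'|apply: extends_from_R1'].
- by move=> m n p q r s D wl _; split; [apply: extends_to_R2|apply: extends_from_R2].
- by move=> a b c x1 x2 x3 x4 x5 x6 D wl wl'; split; apply: extends_to_R3.
- by move=> a b c x1 x2 x3 x4 x5 x6 D wl wl'; split; apply: extends_to_R3'.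
Qed.

Lemma diagram_equiv_rigid (D D' : diagram) :
  diagram_equiv D D' -> rigid D <-> rigid D'.
Proof.
elim=> {D D'} [D D'|D|D D' _ ->|D D' D'' _ -> _ ->] //.
by apply: step_rigid; apply: pd_well_labelled.
Qed.

(** * Nonzero determinant implies rigidity *)

Definition arc (D : pdcode) (e : edge D) : {set edge D} :=
  [set e' | connect (fun x y : edge D => continues D (val x) (val y)) e e'].

Lemma arc_in_arcs (D : pdcode) (e : edge D) : arc e \in arcs D.
Proof. exact: imset_f. Qed.

(** The column of [coloring_matrix] that belongs to the arc through [e]. *)
Definition arc_index (D : pdcode) (e : edge D) : 'I_#|arcs D| :=
  enum_rank_in (arc_in_arcs e) (arc e).

Lemma enum_val_arc_index (D : pdcode) (e : edge D) :
  enum_val (arc_index e) = arc e.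
Proof. by rewrite enum_rankK_in // arc_in_arcs. Qed.

Lemma continues_sym (D : pdcode) (e e' : nat) : continues D e e' = continues D e' e.
Proof.
by apply: eq_has => -[a b c d|a b]; rewrite !inE !xpair_eqE andbC [X in _ || X]andbC orbC.
Qed.

(** Arcs are the classes of a symmetric connectivity relation, so an edge lies on exactly one of
    them. *)
Lemma in_arc_index (D : pdcode) (e : edge D) (k : 'I_#|arcs D|) :
  in_arc (enum_val k) (val e) = (arc_index e == k).
Proof.
have sym : connect_sym (fun x y : edge D => continues D (val x) (val y)).
  by apply: sym_connect_sym => x y; apply: continues_sym.
rewrite /in_arc mem_map ?mem_enum; last exact: val_inj.
apply/idP/eqP => [|<-]; last by rewrite enum_val_arc_index inE connect0.
have /imsetP[e' _ ek] := enum_valP k; rewrite ek inE => ee'.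
apply: enum_val_inj; rewrite enum_val_arc_index ek; apply/setP => z.
by rewrite !inE (same_connect sym ee').
Qed.

Lemma arc_index_eq (D : pdcode) (T : Type) (x : nat -> T) (e e' : edge D) :
  (forall a b, continues D a b -> x a = x b) ->
  arc_index e = arc_index e' -> x (val e) = x (val e').
Proof.
move=> hc ee'.
have : e' \in arc e by rewrite -enum_val_arc_index ee' enum_val_arc_index inE connect0.
rewrite inE => /connectP[p]; elim: p e {ee'} => [|z p IHp] e /= => [_ ->//|].
by case/andP=> /hc -> /IHp; apply.
Qed.

Lemma arc_index_continues (D : pdcode) (e e' : edge D) :
  continues D (val e) (val e') -> arc_index e = arc_index e'.
Proof.
move=> ee'; apply/eqP; rewrite -in_arc_index /in_arc mem_map ?mem_enum; last exact: val_inj.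
by rewrite enum_val_arc_index inE continues_sym in ee' *; apply: connect1.
Qed.

Lemma factor_arc_index (D : pdcode) (T : Type) (x : nat -> T) :
  (forall a b, continues D a b -> x a = x b) ->
  exists w : 'I_#|arcs D| -> T, forall e : edge D, w (arc_index e) = x (val e).
Proof.
(* The default [x 0] is a filler: [e] itself witnesses that its column is hit. *)
move=> hc; exists (fun k => if [pick e | arc_index e == k] is Some e then x (val e) else x 0%N).
move=> e; case: pickP => [e' /eqP /(arc_index_eq hc) //|/(_ e)].
by rewrite eqxx.
Qed.

Lemma arc_index_surj (D : pdcode) (k : 'I_#|arcs D|) : exists e : edge D, arc_index e = k.
Proof.
have /imsetP[e _ ek] := enum_valP k; exists e.
by apply: enum_val_inj; rewrite enum_val_arc_index ek.
Qed.

Lemma sum_in_arc (D : pdcode) (w : 'I_#|arcs D| -> int) (e : edge D) :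
  \sum_k (in_arc (enum_val k) (val e))%:R * w k = w (arc_index e).
Proof.
under eq_bigr do rewrite in_arc_index.
rewrite (bigD1 (arc_index e)) //= eqxx mul1r big1 ?addr0 // => k.
by rewrite eq_sym => /negPf ->; rewrite mul0r.
Qed.

(** Translates between kernel vectors of the matrix and integer colorings. It is read one way to
    deduce rigidity from a minor, the other way to show that a minor of 6_3 is nonzero. *)
Lemma coloring_matrix_mul (D : pdcode) (w : 'I_#|arcs D| -> int) (x : nat -> int) i :
  (forall e : edge D, w (arc_index e) = x (val e)) ->
  \sum_k coloring_matrix D i k * w k =
  if nth (Point 0 0) (crossings D) i is Crossing a b c d
  then x b *+ 2 - x a - x c else 0.
Proof.
move=> wx; have wS e : e \in labels D ->
    \sum_k (in_arc (enum_val k) e)%:R * w k = x e.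
  by move=> eD; rewrite (sum_in_arc w (SeqSub eD)) wx.
under eq_bigr do rewrite mxE.
case E : (nth _ _ _) => [a b c d|a b]; last first.
  by rewrite big1 // => k _; rewrite mul0r.
have vD : Crossing a b c d \in D.
  have: nth (Point 0 0) (crossings D) i \in crossings D.
    (* The default of [nth] is a [Point], so finding a [Crossing] means that the index is in
       range. *)
    by apply: mem_nth; rewrite ltnNge; apply/negP => /(nth_default (Point 0 0)); rewrite E.
  by rewrite E mem_filter.
have xE e : e \in [:: a; b; c; d] -> x e = \sum_k (in_arc (enum_val k) e)%:R * w k.
  by move=> /(mem_labels vD) /wS.
rewrite !xE ?inE ?eqxx ?orbT // -sumrMnl -!sumrB.
by apply: eq_bigr => k _ /=; ring.
Qed.

(** Deleting column [j] amounts to requiring [w j = 0], deleting row [i] to dropping one equation.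
    The transpose appears because [det0P] multiplies by row vectors on the left. *)
Lemma minor_eq0P n (A : 'M[int]_n) (i j : 'I_n) :
  reflect (exists w : 'I_n -> int, [/\ w j = 0, exists k, w k != 0 &
             forall i', i' != i -> \sum_k A i' k * w k = 0])
          (\det (row' i (col' j A)) == 0).
Proof.
rewrite -det_tr; apply: (iffP det0P) => [[v v0 vA]|[w [wj [k wk] wA]]].
- exists (fun k => oapp (v 0) 0 (unlift j k)); split; first by rewrite unlift_none.
    by have /rV0Pn[k vk] := v0; exists (lift j k); rewrite liftK.
  move=> i'; rewrite eq_sym => /unlift_some[r -> _].
  rewrite (bigD1_ord j) //= unlift_none mulr0 add0r.
  have /rowP/(_ r) := vA; rewrite !mxE => vAr; rewrite -[RHS]vAr.
  by apply: eq_bigr => k _; rewrite liftK /= !mxE mulrC.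
- exists (\row_k w (lift j k)).
    apply: contraNneq wk => /rowP w0; case: (unliftP j k) => [k'|] ->; last by rewrite wj.
    by have := w0 k'; rewrite !mxE => ->.
  apply/rowP => r; rewrite !mxE -[RHS](wA (lift i r)); last by rewrite eq_sym neq_lift.
  rewrite (bigD1_ord j) //= wj mulr0 add0r.
  by apply: eq_bigr => k' _; rewrite !mxE mulrC.
Qed.

(** Subtracting its value on the arc of column [j] from a nonconstant coloring leaves a nonzero
    kernel vector of the minor. *)
Lemma minor_rigid (D : pdcode) (i j : 'I_#|arcs D|) :
  \det (row' i (col' j (coloring_matrix D))) != 0 -> rigid D.
Proof.
move=> dN0 x hx.
have [e0 e0j] := arc_index_surj j.
pose z e := x e - x (val e0).
have hz : edge_coloring D z.
  by move=> [a b c d|a b] /hx /=; rewrite /z; lia.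
have [w wz] := factor_arc_index (proj1 (proj2 (edge_coloringP D z) hz)).
exists (x (val e0)); apply/allP=> e eD; apply: contraNT dN0 => xe.
apply/minor_eq0P; exists w; split; first by rewrite -e0j wz /z subrr.
  by exists (arc_index (SeqSub eD)); rewrite wz /z subr_eq0.
move=> i' _; rewrite (coloring_matrix_mul _ wz).
have : edge_coloring (crossings D) z by move=> v; rewrite mem_filter => /andP[_ /hz].
(* Rows beyond the crossings are padding, where the default [Point] makes the equation trivial. *)
case: (ltnP i' (size (crossings D))) => [ltD|/(nth_default (Point 0 0)) -> //].
by move=> /(_ _ (mem_nth (Point 0 0) ltD)); case: (nth _ _ _) => //= a b c d; lia.
Qed.

(** * Rigid palettes with at most five colors *)

(** Since [[::]] is returned in both exhausted cases, subsequences shorter than [k] are listed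
    too. *)
Fixpoint subseqs (T : Type) (k : nat) (s : seq T) : seq (seq T) :=
  match s, k with
  | x :: s', k'.+1 => map (cons x) (subseqs k' s') ++ subseqs k s'
  | _, _ => [:: [::]]
  end.

(** Indices replace colors so that a candidate lift is a plain list; the midpoint is the last
    component [t.2]. *)
Definition midpoints (T : seq 'Z_13) : seq (nat * nat * nat) :=
  let I := iota 0 (size T) in
  [seq t <- [seq (jk, i) | jk <- [seq (j, k) | j <- I, k <- I], i <- I] |
     T`_t.2 *+ 2 == T`_t.1.1 + T`_t.1.2].

Definition midpoints_hold (M : seq (nat * nat * nat)) (v : seq nat) : bool :=
  all (fun t => (nth 0 v t.2).*2 == nth 0 v t.1.1 + nth 0 v t.1.2)%N M.

(* [ok] only prunes the search: correctness rests on [good], tested at the leaves. *)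
Fixpoint search (ok good : pred (seq nat)) (n : nat) (v : seq nat) : bool :=
  if n is n'.+1
  then has (fun x => ok (rcons v x) && search ok good n' (rcons v x)) (iota 0 7)
  else good v.

(** [Ms] sorts the constraints by their largest index, so that each one is tested as soon as its
    last unknown, at position [(size v).-1], has been assigned. *)
Definition liftable (T : seq 'Z_13) : bool :=
  let M := midpoints T in
  let Ms := [seq [seq t <- M | maxn t.1.1 (maxn t.1.2 t.2) == n] | n <- iota 0 (size T)] in
  search (fun v => midpoints_hold (nth [::] Ms (size v).-1) v)
    (fun v => [&& midpoints_hold M v, size v == size T & ~~ constant v]) (size T) [::].

Definition residues : seq 'Z_13 := map inZp (iota 0 13).

(** [behead] discards the multiplier 0; the remaining maps are injective, so with equal sizes an
    inclusion of sets is an equality. *)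
Definition affine_to (T S : seq 'Z_13) : bool :=
  (size T == size S) &&
  has (fun l => has (fun m => all (fun x => l * x + m \in S) T) residues) (behead residues).

Definition rigid_palette (m : nat) (T : {set 'Z_m}) : Prop :=
  forall phi : 'Z_m -> int,
  {in T & &, forall a b c, b *+ 2 = a + c -> phi b *+ 2 = phi a + phi c} ->
  {in T &, forall s t, phi s = phi t}.

Lemma colors_rigid_palette (m : nat) (D : pdcode) (col : nat -> 'Z_m) :
  rigid D -> edge_coloring D col -> rigid_palette (colors D col).
Proof.
move=> rD hcol phi hphi.
have cD e : e \in labels D -> col e \in colors D col.
  by move=> eD; rewrite inE map_f.
have [v vD|k /allP hk] := rD (phi \o col).
  have ev := mem_labels vD.
  case: v vD ev => [a b c d|a b] /hcol /= => [[-> h]|->] // ev; split=> //.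
  by apply: hphi; rewrite ?cD // ev // !inE eqxx ?orbT.
by move=> s t; rewrite !inE => /mapP[e /hk /eqP /= + ->] /mapP[e' /hk /eqP /= + ->] => -> ->.
Qed.

Lemma search_sound (ok good : pred (seq nat)) (n : nat) (v : seq nat) :
  search ok good n v -> exists w, good w.
Proof.
elim: n v => [|n IHn] v; first by exists v.
by move=> /hasP[x _ /andP[_ /IHn]].
Qed.

Lemma mem_subseqs (T : eqType) (p : pred T) (k : nat) (s : seq T) :
  (size (filter p s) <= k)%N -> filter p s \in subseqs k s.
Proof.
elim: s k => [|x s IHs] [|k] //=.
  by case: (if _ then _ else _).
case: (p x) => /= [|/IHs]; rewrite mem_cat; last by move->; rewrite orbT.
by rewrite ltnS => /IHs /(map_f (cons x)) ->.
Qed.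

(** The list found by the search becomes a lift of colors by reading it at the position of a color
    in [s]. As the list is not constant, neither is the lift. *)
Lemma liftable_not_rigid (T : {set 'Z_13}) (s : seq 'Z_13) :
  uniq s -> T =i s -> liftable s -> ~ rigid_palette T.
Proof.
move=> us Ts /search_sound[v /and3P[/allP hM /eqP szv /negP ncv]] rT; apply: ncv.
pose phi x : int := (nth 0%N v (index x s))%:Z.
have {}rT : {in s &, forall x y, phi x = phi y}.
  move=> x y xs ys; apply: rT; rewrite ?Ts // => a b c.
  rewrite !Ts => aT bT cT bac.
  have /hM /= : (index a s, index c s, index b s) \in midpoints s.
    rewrite mem_filter /= !nth_index // bac eqxx /=.
    by apply: allpairs_f; rewrite ?allpairs_f // mem_iota add0n leq0n index_mem.
  by rewrite /phi => /eqP h; rewrite -PoszD -h -addnn PoszD.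
apply/(constantP 0%N); exists (nth 0%N v 0).
apply: (@eq_from_nth _ 0%N); rewrite ?size_nseq // => i iv.
rewrite nth_nseq iv; have is_ : (i < size s)%N by rewrite -szv.
have := rT s`_i s`_0; rewrite !mem_nth ?(leq_ltn_trans _ is_) // => /(_ isT isT).
by rewrite /phi !index_uniq ?(leq_ltn_trans _ is_) // => -[].
Qed.

Local Notation palette := ([set 0; 1; 2; 4; 7] : {set 'Z_13}).

(** A check of the 232 sets made of 0, 1 and at most three more residues. Sets with fewer than five
    elements fail the size test of [affine_to], hence are all liftable. *)
Lemma palette_search :
  all (fun r => affine_to [:: 0, 1 & r] [:: 0; 1; 2; 4; 7] || liftable [:: 0, 1 & r])
    (subseqs 3 (drop 2 residues)).
Proof. by lazy. Qed.

Lemma mem_residues (x : 'Z_13) : x \in residues.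
Proof.
apply/mapP; exists (val x); first by rewrite mem_iota /= (valP x).
by apply: val_inj; rewrite /= modn_small // (valP x).
Qed.

Lemma unit_Z13 (x : 'Z_13) : x != 0 -> x \is a GRing.unit.
Proof.
move=> x0; rewrite -[x]natr_Zp unitZpE // prime_coprime // gtnNdvd ?(ltn_ord x) //.
by rewrite lt0n.
Qed.

Lemma normalized_palette (T : {set 'Z_13}) :
  0 \in T -> 1 \in T -> (#|T| <= 5)%N -> rigid_palette T ->
  #|T| = 5%N /\ exists l m, l != 0 /\ {in T, forall x, l * x + m \in palette}.
Proof.
(* Filtering keeps the order of [residues], so [r] is one of the subsequences covered by the
   search. *)
move=> T0 T1 leT rT; pose r := [seq x <- drop 2 residues | x \in T].
have ur : uniq [:: 0, 1 & r].
  apply: (@subseq_uniq _ _ [:: 0, 1 & drop 2 residues]); last by lazy.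
  exact: (cat_subseq (subseq_refl [:: 0; 1]) (filter_subseq _ _)).
have Tr : T =i [:: 0, 1 & r].
  move=> x; rewrite !inE mem_filter; have := mem_residues x.
  rewrite -{1}[residues](cat_take_drop 2) mem_cat.
  have [->|x0] := eqVneq x 0; first by rewrite T0.
  have [->|x1] := eqVneq x 1; first by rewrite T1.
  have -> : take 2 residues = [:: 0; 1] by apply/eqP.
  by rewrite !inE (negPf x0) (negPf x1) /= => ->; rewrite andbT.
have cT : #|T| = size [:: 0, 1 & r] by rewrite (eq_card Tr); apply/card_uniqP.
have := allP palette_search r; rewrite mem_subseqs; last by move: leT; rewrite cT.
case/(_ isT)/orP=> [|/(liftable_not_rigid ur Tr) //].
case/andP=> /eqP sz /hasP[l lr /hasP[m _ /allP h]]; split; first by rewrite cT sz.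
exists l, m; split; first by apply: contraTneq lr => ->.
by move=> x; rewrite Tr => /h; rewrite !inE -!orbA.
Qed.

(** Two distinct colors [s] and [t] are sent to 0 and 1 by an affine map, invertible because 13 is
    prime. Affine maps preserve midpoints, so they preserve rigidity. *)
Lemma rigid_palette_affine (T : {set 'Z_13}) :
  (1 < #|T| <= 5)%N -> rigid_palette T ->
  #|T| = 5%N /\ exists l m, l != 0 /\ {in T, forall x, l * x + m \in palette}.
Proof.
case/andP=> /card_gt1P[s [t [sT tT st]]] leT rT.
have du : t - s \is a GRing.unit by rewrite unit_Z13 // subr_eq0 eq_sym.
pose g x := (x - s) / (t - s).
have gI : injective g by move=> x y /(divIr du) /addIr.
have cT : #|g @: T| = #|T| by rewrite card_imset.
have [||||c5 [l [m [l0 h]]]] := @normalized_palette (g @: T).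
- by apply/imsetP; exists s; rewrite // /g subrr mul0r.
- by apply/imsetP; exists t; rewrite // /g divrr.
- by rewrite cT.
- move=> phi hphi x y /imsetP[x' x'T ->] /imsetP[y' y'T ->].
  apply: (rT (phi \o g)) => // a b c aT bT cT' bac /=.
  apply: hphi; rewrite ?imset_f // /g -mulrnAl mulrnBl bac -mulrDl.
  by congr (_ / _); ring.
split; first by rewrite -cT.
exists (l / (t - s)), (m - l * s / (t - s)); split.
  by apply: contra_neq l0 => /(canRL (divrK du)); rewrite mul0r.
move=> x xT; rewrite (_ : _ + _ = l * g x + m) ?h ?imset_f // /g.
by rewrite mulrBl mulrBr; ring.
Qed.

Lemma card_palette : #|palette| = 5%N.
Proof.
rewrite (@eq_card _ _ (mem [:: 0; 1; 2; 4; 7])) => [|x]; last by rewrite !inE -!orbA.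
exact/card_uniqP.
Qed.

Lemma affine_colorset_equiv (S : {set 'Z_13}) (l m : 'Z_13) :
  l != 0 -> #|S| = 5%N -> {in S, forall x, l * x + m \in palette} ->
  colorset_equiv S palette.
Proof.
move=> l0 cS h.
have fI : injective (fun x : 'Z_13 => l * x + m).
  by move=> x y /addIr /(mulrI (unit_Z13 l0)).
exists (perm fI); split; first by move=> x y; rewrite !permE /fox_op; ring.
apply/eqP; rewrite eqEcard card_imset ?cS; last exact: perm_inj.
rewrite card_palette leqnn andbT.
by apply/subsetP => _ /imsetP[x /h + ->]; rewrite permE.
Qed.

(** * The knot 6_3 *)

(** [h] is a complete invariant of components that takes every value below [k], so it maps the
    chosen roots bijectively onto ['I_k]. *)
Lemma n_comp_classes (T : finType) (e : rel T) (h : T -> nat) (k : nat) :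
  (forall x, h x < k)%N -> (forall i, (i < k)%N -> exists x, h x = i) ->
  (forall x y, e x y -> h x = h y) -> (forall x y, h x = h y -> connect e x y) ->
  n_comp e T = k.
Proof.
move=> hk hs he hc.
have ch x y : connect e x y -> h x = h y.
  case/connectP=> p + ->; elim: p x => //= z p IHp x /andP[/he -> /IHp ->//].
have sym : connect_sym e by move=> x y; apply/idP/idP => /ch /esym /hc.
pose g (x : T) : 'I_k := Ordinal (hk x).
rewrite /n_comp_mem -(@card_in_imset _ _ g).
  rewrite -[RHS]card_ord; apply: eq_card => i; rewrite [RHS]inE; apply/imsetP.
  have [x xi] := hs i (ltn_ord i); exists (fingraph.root e x).
    by rewrite inE /= roots_root.
  by apply: val_inj; rewrite /= -(ch _ _ (connect_root e x)).
move=> x y /andP[/eqP rx _] /andP[/eqP ry _] /(congr1 val) /= /hc.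
by move/(fingraph.rootP sym); rewrite rx ry.
Qed.

(** * Darts as pairs of numbers, and counting their orbits *)

Definition dart_codes (D : pdcode) : seq (nat * nat) :=
  [seq (i, j) | i <- iota 0 (size D), j <- iota 0 (size (ends (nth (Point 0 0) D i)))].

Definition dart_code (D : pdcode) (x : dart D) : nat * nat := (val (tag x), val (tagged x)).

Definition code_label (D : pdcode) (p : nat * nat) : nat :=
  nth 0%N (ends (nth (Point 0 0) D p.1)) p.2.

Definition code_node (D : pdcode) (p : nat * nat) : nat * nat :=
  (p.1, p.2.+1 %% size (ends (nth (Point 0 0) D p.1)))%N.

Definition code_mates (D : pdcode) (p : nat * nat) : seq (nat * nat) :=
  [seq q <- dart_codes D | (q != p) && (code_label D q == code_label D p)].

Definition code_other_end (D : pdcode) (p : nat * nat) : nat * nat :=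
  head p (code_mates D p).

(* [dart_code] transports darts to pairs of numbers, on which the orbits can be
   computed. *)
Lemma dart_code_inj (D : pdcode) : injective (@dart_code D).
Proof.
move=> [i j] [i' j'] [/= /val_inj ii']; case: i' / ii' in j' *.
by move/val_inj ->.
Qed.

Lemma mem_dart_codes (D : pdcode) (x : dart D) : dart_code x \in dart_codes D.
Proof.
case: x => i j; apply/allpairsPdep; exists (val i), (val j).
rewrite !mem_iota !add0n !leq0n ltn_ord; split=> //=.
by rewrite -[D in nth _ D]/(val (in_tuple D)) -tnth_nth ltn_ord.
Qed.

Lemma dart_codeP (D : pdcode) (p : nat * nat) :
  p \in dart_codes D -> exists x : dart D, dart_code x = p.
Proof.
case/allpairsPdep=> i [j []]; rewrite !mem_iota !add0n !leq0n /= => iD jD ->.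
have jD' : (j < size (ends (tnth (in_tuple D) (Ordinal iD))))%N by rewrite (tnth_nth (Point 0 0)).
by exists (Tagged (fun v => 'I_(size (ends (tnth (in_tuple D) v)))) (Ordinal jD')).
Qed.

Lemma dart_code_label (D : pdcode) (x : dart D) : dart_label x = code_label D (dart_code x).
Proof. by congr (nth 0%N (ends _) _); apply: tnth_nth. Qed.

Lemma dart_code_node (D : pdcode) (x : dart D) :
  dart_code (node x) = code_node D (dart_code x).
Proof. by congr (_, (_ %% size (ends _))%N); apply: tnth_nth. Qed.

(** When every dart has exactly one mate, [pick] and [head] agree whatever the order of
    enumeration. *)
Lemma dart_code_other_end (D : pdcode) (x : dart D) :
  all (fun p => size (code_mates D p) == 1%N) (dart_codes D) ->
  dart_code (other_end x) = code_other_end D (dart_code x).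
Proof.
move=> /allP /(_ _ (mem_dart_codes x)); rewrite /code_other_end.
case E : (code_mates _ _) => [|p []] // _ /=.
have mate y : (y != x) && (dart_label y == dart_label x) = (dart_code y == p).
  have <- : (dart_code y \in code_mates D (dart_code x)) = (dart_code y == p).
    by rewrite E inE.
  rewrite mem_filter mem_dart_codes andbT !dart_code_label.
  by rewrite (inj_eq (@dart_code_inj D)).
rewrite /other_end; case: pickP => [y|none] /=; first by rewrite mate => /eqP.
have : p \in code_mates D (dart_code x) by rewrite E inE.
rewrite mem_filter => /andP[_ /dart_codeP[y /eqP]].
by rewrite -mate none.
Qed.

Lemma card_dart (D : pdcode) : #|dart D| = size (dart_codes D).
Proof.
rewrite cardE -(size_map (@dart_code D)); apply/perm_size/uniq_perm.
- by rewrite map_inj_uniq ?enum_uniq //; apply: dart_code_inj.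
- by apply: allpairs_uniq_dep => [|i _|[i j] [i' j'] _ _ [-> ->]]; rewrite ?iota_uniq.
- move=> p; apply/mapP/idP => [[x _ ->]|/dart_codeP[x xp]]; first exact: mem_dart_codes.
  by exists x; rewrite ?mem_enum.
Qed.

Lemma connect_traject (D : pdcode) (e : rel (dart D)) (f : dart D -> dart D)
    (fc : nat * nat -> nat * nat) (x : dart D) (n : nat) (q : nat * nat) :
  (forall y, dart_code (f y) = fc (dart_code y)) -> (forall y, connect e y (f y)) ->
  q \in traject fc (dart_code x) n -> exists2 y, dart_code y = q & connect e x y.
Proof.
move=> ff ef /trajectP[i _ ->]; elim: i => [|i [y yi xy]]; first by exists x; rewrite ?connect0.
by exists (f y); [rewrite ff yi | apply: connect_trans (ef y)].
Qed.

(** [rs] lists one representative per orbit and [n] bounds the trajectories; [h p] is the position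
    of the first representative that reaches [p]. Checking that [p] also reaches it back gives a
    path between any two darts with the same [h]. *)
Lemma fcard_dart (D : pdcode) (f : dart D -> dart D) (fc : nat * nat -> nat * nat)
    (n : nat) (rs : seq (nat * nat)) :
  let h p := find (fun r => p \in traject fc r n) rs in
  (forall x, dart_code (f x) = fc (dart_code x)) ->
  all (fun p => [&& (h p < size rs)%N, h (fc p) == h p &
                    nth (0, 0)%N rs (h p) \in traject fc p n]) (dart_codes D) ->
  all (fun i => (nth (0, 0)%N rs i \in dart_codes D) && (h (nth (0, 0)%N rs i) == i))
    (iota 0 (size rs)) ->
  fcard f (dart D) = size rs.
Proof.
move=> h ff /allP hp /allP hi.
have {}hp x := hp _ (mem_dart_codes x).
have ef x : connect (frel f) x (f x) by apply: connect1; rewrite /=.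
apply: (@n_comp_classes _ _ (fun x => h (dart_code x))).
- by move=> x; case/and3P: (hp x).
- move=> i lti; have /hi /andP[/dart_codeP[x <-] /eqP] : i \in iota 0 (size rs) by rewrite mem_iota.
  by exists x.
- by move=> x y /= /eqP <-; rewrite ff; case/and3P: (hp x) => _ /eqP.
move=> x y xy; case/and3P: (hp x) => lth _ /(connect_traject ff ef)[z zr xz].
apply: connect_trans xz _.
move: lth; rewrite xy -has_find => /(nth_find (0, 0)%N).
rewrite -/(h _) -xy -zr => /(connect_traject ff ef)[y' /dart_code_inj ->].
exact.
Qed.

(** At a crossing, [g] goes to the far end of the edge and then straight on, so it travels along a
    link component. For a knot one trip meets one dart of each edge, and the remaining darts are
    their other ends. *)
Lemma connected_dart (D : pdcode) (n : nat) (p0 : nat * nat) :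
  let o := code_other_end D in
  let g p := code_node D (code_node D (o p)) in
  (forall x : dart D, dart_code (other_end x) = o (dart_code x)) ->
  p0 \in dart_codes D ->
  all (fun p => ((p \in traject g p0 n) || (p \in map o (traject g p0 n))) &&
                ((p0 \in traject g p n) || (p0 \in traject g (o p) n))) (dart_codes D) ->
  n_comp (@graph_adj D) (dart D) = 1%N.
Proof.
move=> o g oE /dart_codeP[x0 <-] /allP hp.
have eo x : connect (@graph_adj D) x (other_end x).
  by apply: connect1; rewrite /graph_adj /= eqxx orbT.
have en x : connect (@graph_adj D) x (node x).
  by apply: connect1; rewrite /graph_adj /= eqxx.
pose f (x : dart D) := node (node (other_end x)).
have ff x : dart_code (f x) = g (dart_code x) by rewrite !dart_code_node oE.
have ef x : connect (@graph_adj D) x (f x).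
  by apply: connect_trans (eo x) (connect_trans (en _) (en _)).
apply: (@n_comp_classes _ _ (fun=> 0%N)) => // [[|//] _|x y _]; first by exists x0.
apply: (@connect_trans _ _ x0).
  case/andP: (hp _ (mem_dart_codes x)) => _ /orP[|].
    by case/(connect_traject ff ef) => z /dart_code_inj ->.
  rewrite -oE => /(connect_traject ff ef)[z /dart_code_inj -> ].
  exact: connect_trans.
case/andP: (hp _ (mem_dart_codes y)) => + _; case/orP=> [|/mapP[q qg yq]].
  by case/(connect_traject ff ef) => z /dart_code_inj ->.
have [z zq xz] := connect_traject ff ef qg.
by move: yq; rewrite -zq -oE => /dart_code_inj ->; apply: connect_trans (eo z).
Qed.

(* The PD code of KnotInfo; the determinant is 13. *)
Definition knot63 : pdcode :=
  [:: Crossing 4 2 5 1; Crossing 8 4 9 3; Crossing 12 9 1 10;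
      Crossing 10 5 11 6; Crossing 6 11 7 12; Crossing 2 8 3 7].

Lemma well_labelled_knot63 : well_labelled knot63.
Proof. by []. Qed.

Lemma planar_knot63 : planar knot63.
Proof.
have mates : all (fun p => size (code_mates knot63 p) == 1%N) (dart_codes knot63) by lazy.
have oE (x : dart knot63) := dart_code_other_end x mates.
(* One dart per face. Euler's formula reads 6 + 8 = 12 + 2; below, 12 counts the passages through
   crossings in one trip and 6 bounds the number of sides of a face. *)
pose reps := [:: (0, 0); (0, 1); (0, 2); (0, 3); (1, 0); (1, 3); (2, 0); (3, 3)]%N.
rewrite /planar card_dart (@connected_dart _ 12 (0, 1)%N oE); [|by lazy|by lazy].
rewrite (@fcard_dart _ _ (fun p => code_node knot63 (code_other_end knot63 p)) 6 reps) //.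
by move=> x; rewrite dart_code_node oE.
Qed.

Definition diagram63 : diagram := Diagram well_labelled_knot63 planar_knot63.

Lemma link63_class : exists D0, forall D, diagram_equiv diagram63 D <-> diagram_equiv D0 D.
Proof. by exists diagram63. Qed.

Definition link63 : link := Link link63_class.

Lemma colorable_link63 : colorable 13 link63.
Proof.
(* Labels start at 1, so entry 0 is a filler; each arc consists of the edges [2k-1] and [2k]. *)
pose col e : 'Z_13 := inZp (nth 0 [:: 0; 0; 0; 1; 1; 12; 12; 7; 7; 8; 8; 3; 3] e)%N.
exists diagram63, col; split; first exact: rst_refl.
split.
  apply/edge_coloringP; do 6!(apply/edge_coloring_cons; split; first by split; apply/eqP).
  by [].
apply/card_gt1P; exists (col 1), (col 3); split=> //.
by rewrite inE map_f.
by rewrite inE map_f.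
Qed.

(* With fewer arcs than crossings, [coloring_matrix] would omit some crossings. *)
Lemma card_arcs63 : (6 <= #|arcs knot63|)%N.
Proof.
(* A numbering of the six arcs; being constant along arcs, it separates six columns. *)
pose x e := nth 0%N [:: 0; 0; 0; 1; 1; 2; 2; 3; 3; 4; 4; 5; 5]%N e.
have hc a b : continues knot63 a b -> x a = x b.
  rewrite /continues /= !inE orbF -!orbA.
  by do ![case/orP] => /eqP[-> ->].
have [w wx] := factor_arc_index hc.
pose es : seq (edge knot63) :=
  [:: @SeqSub _ (labels knot63) 1 isT; @SeqSub _ (labels knot63) 3 isT;
      @SeqSub _ (labels knot63) 5 isT; @SeqSub _ (labels knot63) 7 isT;
      @SeqSub _ (labels knot63) 9 isT; @SeqSub _ (labels knot63) 11 isT].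
have : uniq (map w (map (@arc_index _) es)) by rewrite /= !wx.
by move/map_uniq/card_uniqP => /= <-; rewrite -[leqRHS]card_ord max_card.
Qed.

Lemma continues_labels (D : pdcode) (a b : nat) :
  continues D a b -> a \in labels D /\ b \in labels D.
Proof.
case/hasP=> v vD vab; have h := mem_labels vD.
by case: v vab {vD} h => [x y z t|x y] /=; rewrite !inE => /orP[]/eqP[-> ->] h;
  split; apply: h; rewrite !inE eqxx ?orbT.
Qed.

(** The determinant is never evaluated: five crossing equations and the value 0 on the arc of edge 1
    leave only the zero coloring, so the minor has no kernel. *)
Lemma nonzero_determinant_link63 : nonzero_determinant link63.
Proof.
pose i : 'I_#|arcs knot63| := Ordinal (leq_trans (isT : (0 < 6)%N) card_arcs63).
pose e1 : edge knot63 := @SeqSub _ (labels knot63) 1%N isT.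
pose j := arc_index e1.
exists (absz (\det (row' i (col' j (coloring_matrix knot63))))); split.
  by exists diagram63; split; [exact: rst_refl | exists i, j].
rewrite absz_eq0; apply/minor_eq0P => -[w [wj [k wk] hw]].
(* Reads the kernel vector back as a coloring of edges, 0 outside the labels. *)
pose x e := if insub e is Some e' then w (arc_index (e' : edge knot63)) else 0.
have wx (e : edge knot63) : w (arc_index e) = x (val e) by rewrite /x valK.
have xc a b : continues knot63 a b -> x a = x b.
  move=> ab; have [aK bK] := continues_labels ab.
  by rewrite -(wx (SeqSub aK)) -(wx (SeqSub bK)); congr w; apply: arc_index_continues.
have row r : (0 < r)%N -> (r < 6)%N ->
    (if nth (Point 0 0) (crossings knot63) r is Crossing a b c d
     then x b *+ 2 - x a - x c else 0) = 0.
  move=> r0 r6; have lt := leq_trans r6 card_arcs63.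
  by rewrite -(coloring_matrix_mul (Ordinal lt) wx) hw // -val_eqE -lt0n.
have x1 : x 1%N = 0 by rewrite -(wx e1) wj.
have /= r1 := row 1%N isT isT; have /= r2 := row 2%N isT isT.
have /= r3 := row 3%N isT isT; have /= r4 := row 4%N isT isT.
have /= r5 := row 5%N isT isT.
have x2 : x 2%N = x 1%N by apply: xc.
have x4 : x 4%N = x 3%N by apply: xc.
have x6 : x 6%N = x 5%N by apply: xc.
have x8 : x 8%N = x 7%N by apply: xc.
have x10 : x 10%N = x 9%N by apply: xc.
have x12 : x 12%N = x 11%N by apply: xc.
have [e ek] := arc_index_surj k.
have x0 : all (fun e => x e == 0) (labels knot63).
  rewrite /=; clear -x1 x2 x4 x6 x8 x10 x12 r1 r2 r3 r4 r5; lia.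
by case/negP: wk; rewrite -ek wx; apply: (allP x0); apply: valP.
Qed.

(** * From diagrams to links and their color sets *)

(** The nonzero minor may come from another diagram of the link, so rigidity is carried over by
    Reidemeister moves. *)
Lemma nonzero_determinant_rigid (L : link) (D : diagram) :
  nonzero_determinant L -> diagram_of L D -> rigid D.
Proof.
case=> d [[D' [LD' [i [j dE]]]] d0] LD; have [D0 hL] := link_class L.
apply/(diagram_equiv_rigid (D' := D')); last first.
  by apply: (minor_rigid (i := i) (j := j)); rewrite -absz_eq0 -dE.
by apply: rst_trans (rst_sym _ _ _ _ (proj1 (hL D) LD)) (proj1 (hL D') LD').
Qed.

Lemma colorset_equiv_palette (L : link) (S : {set 'Z_13}) :
  nonzero_determinant L -> #|S| = 5%N -> colorable_from L S ->
  colorset_equiv S palette.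
Proof.
move=> detL cS [D [col [LD [hcol ntc] colS]]].
have rT : rigid_palette (colors D col).
  by apply: colors_rigid_palette; [exact: nonzero_determinant_rigid LD | apply/edge_coloringP].
have leT : (1 < #|colors D col| <= 5)%N by rewrite ntc (leq_trans (subset_leq_card colS)) ?cS.
have [cT [l [m [l0 h]]]] := rigid_palette_affine leT rT.
(* The colors used form a subset of [S] that already has five elements. *)
suff <- : colors D col = S by apply: affine_colorset_equiv h.
by apply/eqP; rewrite eqEcard colS cS cT.
Qed.

Lemma colorable_from_equiv (m : nat) (L : link) (S S' : {set 'Z_m}) :
  colorset_equiv S S' -> colorable_from L S -> colorable_from L S'.
Proof.
case=> f [fA <-] [D [col [LD [[hc hx] ntc] colS]]].
have cE : colors D (f \o col) = f @: colors D col.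
  apply/setP => x; rewrite inE; apply/mapP/imsetP => [[e eD xe]|[c]].
    by exists (col e); rewrite // inE map_f.
  by rewrite inE => /mapP[e eD ->] xe; exists e.
exists D, (f \o col); rewrite cE; split=> //; last exact: imsetS.
split; last by rewrite cE card_imset //; apply: perm_inj.
split=> [e e' /hc /= -> //|a b c d /hx /= bac].
(* An automorphism is only known to preserve [fox_op], so the crossing equation is first put in that
   form. *)
have -> : col a = fox_op (col c) (col b) by rewrite /fox_op bac addrK.
by rewrite fA /fox_op subrK.
Qed.

Lemma is_minimum_inj (P : nat -> Prop) (n n' : nat) :
  is_minimum P n -> is_minimum P n' -> n = n'.
Proof. by case=> Pn mn [Pn' mn']; apply/eqP; rewrite eqn_leq mn ?mn'. Qed.

Local Close Scope ring_scope.

Theorem theorem13 :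
  let S0 : {set 'Z_13} := [set 0; 1; 2; 4; 7]%R in
  (forall L : link, colorable 13 L -> nonzero_determinant L ->
     forall S : {set 'Z_13}, #|S| = 5 -> colorable_from L S ->
       colorset_equiv S S0) /\
  ((forall L' : link, colorable 13 L' -> nonzero_determinant L' ->
      is_mincol 13 L' 5) ->
   common_minimal_sufficient S0 /\
   (forall S : {set 'Z_13}, common_minimal_sufficient S ->
      colorset_equiv S S0)).
Proof.
move=> S0; split=> [L _ detL S|mincol5]; first exact: colorset_equiv_palette.
split=> [|S [minS suffS]].
  split=> [|L colL detL]; first by rewrite /S0 card_palette.
  (* The colors of a minimal coloring form a five-element set, equivalent to [S0] by the first part;
     the coloring is moved along that equivalence. *)
  have [[D [LD [[col [ntc c5]] _]]] _] := mincol5 L colL detL.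
  have LT : colorable_from L (colors D col) by exists D, col.
  exact: (colorable_from_equiv (colorset_equiv_palette detL c5 LT) LT).
(* A concrete link is needed to compare the two minima and conclude [#|S| = 5]. *)
have col63 := colorable_link63; have det63 := nonzero_determinant_link63.
apply: (colorset_equiv_palette det63); last exact: suffS.
exact: is_minimum_inj (minS _ col63 det63) (mincol5 _ col63 det63).
Qed.
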